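(* Let $m\ge1$ and $q=6m$. If $N(4,q,1)=\dfrac{q^2(q+2)}{4}$, then $N(4,2q,1)=\dfrac{(2q)^2(2q+2)}{4}$.
   Context: $B_q=\{0,\dots,q-1\}$ and $B_q^4$ is the set of words of length 4 over $B_q$. $N(4,q,1)$ is the maximum cardinality of a code $C\subseteq B_q^4$ capable of correcting single deletions, i.e. such that the sets $\lfloor x\rfloor_1$ ($x\in C$) of words obtained from $x$ by deleting one letter are pairwise disjoint (equivalently, the minimum deletion–insertion distance between distinct codewords exceeds 2). *)

(* Defs.v *)
From mathcomp Require Import all_boot.
Set Implicit Arguments. Unset Strict Implicit. Unset Printing Implicit Defensive.

Definition del_at (T : Type) (i : nat) (s : seq T) : seq T :=
  take i s ++ drop i.+1 s.

Definition del1 (n q : nat) (x : n.-tuple 'I_q) : seq (seq 'I_q) :=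
  [seq del_at i (val x) | i <- iota 0 n].

Definition single_del_code (n q : nat) (C : {set n.-tuple 'I_q}) : bool :=
  [forall x in C, forall y in C,
     (x != y) ==> ~~ has (fun w => w \in del1 y) (del1 x)].

Definition N1 (n q : nat) : nat :=
  \max_(C : {set n.-tuple 'I_q} | single_del_code C) #|C|.

(* Main.v *)
Require Import Defs.
From mathcomp Require Import all_boot all_algebra zify.

(* Upper bound for even q: give the word abc the weight 1 + [a = b] + [b = c], so
   that the total weight is q^3 + 2 q^2. Every non-constant word of length 4 has
   subwords of length 3 of total weight at least 4, and at least 5 (resp. 6) if it
   has an odd number of subwords abc with a, c <> b for one (resp. two) middle
   letters b. Since there are (q - 1)^2 such subwords for a given b, an odd number,
   each b forces a loss of 1, which makes up for the constant codewords aaaa, whose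
   subword aaa weighs only 3.

   Lower bound: take two disjoint copies of the alphabet, an optimal code on each,
   and a code partitioning (by its subwords) all the words of length 3 that use
   both copies, each codeword having 4 subwords except for the words aabb. Write
   the alphabet of size q = 6 m as 'Z_3 * bool * Z with #|Z| = m. Words with two
   adjacent letters in the same block bool * Z are covered by words xx'yy' with
   x, x' in one block, y, y' in one block, the edges xx' and yy' having the same
   color in a 1-factorization of the complete graph on bool * Z. All other words
   are covered by a blow-up of an explicit design for m = 1. *)

Set Implicit Arguments.
Unset Strict Implicit.
Unset Printing Implicit Defensive.

(** * Deletion and insertion of a letter in short words *)

Section Words.
Variable T : Type.
Implicit Types (w : T * T * T) (v : T * T * T * T) (x : T).

(** Positions beyond 3 act as 3, so the identities relating [del], [ins] and [letter] need no bound
    on [j]. *)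
Definition del (j : nat) v : T * T * T :=
  let: (a, b, c, d) := v in
  match j with 0 => (b, c, d) | 1 => (a, c, d) | 2 => (a, b, d) | _ => (a, b, c) end.

Definition letter (j : nat) v : T :=
  let: (a, b, c, d) := v in match j with 0 => a | 1 => b | 2 => c | _ => d end.

Definition ins (j : nat) x w : T * T * T * T :=
  let: (a, b, c) := w in
  match j with
  | 0 => (x, a, b, c) | 1 => (a, x, b, c) | 2 => (a, b, x, c) | _ => (a, b, c, x)
  end.

Lemma ins_del j v : ins j (letter j v) (del j v) = v.
Proof. by case: v => [[[a b] c] d]; case: j => [|[|[|j]]]. Qed.

Lemma del_ins j x w : del j (ins j x w) = w.
Proof. by case: w => [[a b] c]; case: j => [|[|[|j]]]. Qed.

Lemma delP (P : T * T * T -> Prop) a b c d :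
  P (b, c, d) -> P (a, c, d) -> P (a, b, d) -> P (a, b, c) ->
  forall j, P (del j (a, b, c, d)).
Proof. by move=> ? ? ? ? [|[|[|j]]]. Qed.

End Words.

Section MapWords.
Variables (T U : Type) (f : T -> U).

Definition map3 (w : T * T * T) := let: (a, b, c) := w in (f a, f b, f c).
Definition map4 (v : T * T * T * T) :=
  let: (a, b, c, d) := v in (f a, f b, f c, f d).

Lemma map3_del j v : map3 (del j v) = del j (map4 v).
Proof. by case: v => [[[a b] c] d]; case: j => [|[|[|j]]]. Qed.

Lemma map4_ins j x w : map4 (ins j x w) = ins j (f x) (map3 w).
Proof. by case: w => [[a b] c]; case: j => [|[|[|j]]]. Qed.

Lemma letter_map4 j v : letter j (map4 v) = f (letter j v).
Proof. by case: v => [[[a b] c] d]; case: j => [|[|[|j]]]. Qed.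

Lemma map4_inj : injective f -> injective map4.
Proof.
by move=> fI [[[a b] c] d] [[[a' b'] c'] d'] [/fI-> /fI-> /fI-> /fI->].
Qed.

Lemma map3_inj : injective f -> injective map3.
Proof. by move=> fI [[a b] c] [[a' b'] c'] [/fI-> /fI-> /fI->]. Qed.

End MapWords.

(** * The design on twice six letters *)

(* A letter is ((t, r), s): it lies in copy t of the alphabet 'Z_3 * 'Z_2, with
   None, Some false, Some true standing for r = 0, 1, 2. *)
Definition block_label := (bool * option bool)%type.
Definition base := (block_label * bool)%type.

Definition add3 (r r' : option bool) : option bool :=
  match r, r' with
  | None, _ => r' | _, None => r
  | Some false, Some false => Some true | Some true, Some true => Some false
  | _, _ => None
  end.
Definition opp3 (r : option bool) : option bool := omap negb r.

Definition base_of_nat (n : nat) : base :=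
  ((5 < n, nth None [:: None; Some false; Some true] (n %% 6)./2), odd n).
Definition nat_of_base (l : base) : nat :=
  let: ((t, r), s) := l in
  6 * t + (if r is Some b then if b then 4 else 2 else 0) + s.

Definition translate (p : block_label) (l : base) : base :=
  ((p.1 (+) l.1.1, add3 p.2 l.1.2), l.2).
Definition untranslate (p : block_label) (l : base) : base :=
  ((p.1 (+) l.1.1, add3 (opp3 p.2) l.1.2), l.2).

(* Found by computer search (a SAT solver): together with its translates by
   block_label, this list covers exactly once each three-letter word that uses both
   copies and has no two adjacent letters in the same block {(t, r)} * 'Z_2.
   The letter ((t, r), s) is encoded as 6 t + 2 r + s. *)
Definition design : seq (base * base * base * base) :=
  map (map4 base_of_nat) [::
  (0,2,6,8); (0,3,8,6); (0,3,11,9); (0,4,6,9); (0,5,9,7); (0,6,2,10);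
  (0,6,11,0); (0,7,8,2); (0,7,9,1); (0,7,10,5); (0,7,11,3); (0,8,7,0);
  (0,8,10,1); (0,9,5,11); (0,9,6,4); (0,9,10,2); (0,10,4,7); (0,10,8,3);
  (0,10,9,0); (0,11,2,7); (0,11,4,8); (0,11,6,1); (1,5,6,8); (1,6,3,9);
  (1,6,5,11); (1,7,2,11); (1,7,8,1); (1,7,9,4); (1,7,10,0); (1,8,3,6);
  (1,8,4,7); (1,8,11,0); (1,9,5,10); (1,9,6,0); (1,9,11,1); (1,10,4,9);
  (1,10,6,1); (1,10,7,5); (1,10,8,2); (1,11,3,8); (1,11,5,7); (1,11,6,2)].

Definition design_entries : seq (base * base * base * (nat * base)) :=
  flatten [seq [seq let w := del j v in let p := w.1.1.1 in
                    (map3 (untranslate p) w, (j, untranslate p (letter j v)))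
               | j <- iota 0 4] | v <- design].

(** After translation the first letter lies in block [(false, None)], so its code is 0 or 1. The
    table is computed once, which makes [completion] a lookup. *)
Definition design_table : seq (seq (seq (option (nat * base)))) :=
  Eval vm_compute in
  [seq [seq [seq omap snd (ohead [seq e <- design_entries |
                 e.1 == (base_of_nat a, base_of_nat b, base_of_nat c)])
            | c <- iota 0 12] | b <- iota 0 12] | a <- iota 0 2].

Definition completion (w : base * base * base) : option (nat * base) :=
  let: (a, b, c) := w in
  let index l := nat_of_base (untranslate a.1 l) in
  omap (fun e => (e.1, translate a.1 e.2))
    (nth None (nth [::] (nth [::] design_table (index a)) (index b)) (index c)).

Definition same_block (K : Type) (a b : block_label * K) := a.1 == b.1.

Definition block_word (K : Type)
    (w : block_label * K * (block_label * K) * (block_label * K)) :=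
  let: (a, b, c) := w in same_block a b || same_block b c.

Definition mixed3 (K : Type)
    (w : block_label * K * (block_label * K) * (block_label * K)) :=
  let: (a, b, c) := w in ~~ ((a.1.1 == b.1.1) && (b.1.1 == c.1.1)).

(** All four subwords must lead back to the same codeword: this yields uniqueness of the covering as
    well as existence. *)
Definition completion_ok (w : base * base * base) : bool :=
  if completion w is Some (i, l) then
    let v := ins i l w in
    all (fun j => [&& mixed3 (del j v), ~~ block_word (del j v) &
                      completion (del j v) == Some (j, letter j v)]) (iota 0 4)
    && (i < 4)
  else false.

Definition all_base := [seq base_of_nat n | n <- iota 0 12].

Lemma mem_all_base l : l \in all_base.
Proof. by move: l => [[[] [[]|]] []]. Qed.

Lemma completion_check :
  all (fun a => all (fun b => all (fun c =>
    mixed3 (a, b, c) && ~~ block_word (a, b, c) ==> completion_ok (a, b, c))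
    all_base) all_base) all_base.
Proof. by vm_compute. Qed.

Lemma completionP w : mixed3 w -> ~~ block_word w ->
  exists i l, [/\ completion w = Some (i, l), i < 4 &
    forall j, j < 4 -> let v := ins i l w in
      [/\ mixed3 (del j v), ~~ block_word (del j v) &
          completion (del j v) = Some (j, letter j v)]].
Proof.
case: w => [[a b] c] mw bw.
move: completion_check => /allP/(_ a (mem_all_base a)) /allP/(_ b (mem_all_base b)).
move=> /allP/(_ c (mem_all_base c)); rewrite mw bw implyTb /completion_ok.
case: (completion (a, b, c)) => [[i l]|] // /andP[/allP ok lti]; exists i, l.
split=> // j ltj; have /ok/and3P[mj bj /eqP cj] : j \in iota 0 4 by rewrite mem_iota.
by split.
Qed.

Arguments completion : simpl never.

(** * Completing a mixed word to a codeword *)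

Section Completion.
Variable Z : finZmodType.
Import GRing.Theory.
Local Open Scope ring_scope.

Definition vertex := (bool * Z)%type.
Implicit Types x y : vertex.

(* A 1-factorization of the complete graph on bool * Z: color classes (false, t)
   match i with t - i on each side, fixed points being matched across, and the
   classes (true, t) match i with i + t across; (true, 0) is reserved for the
   diagonal. *)
Definition color x y : vertex :=
  if x.1 == y.1 then if x.2 == y.2 then (true, 0) else (false, x.2 + y.2)
  else if x.2 == y.2 then (false, x.2 + y.2)
  else (true, if x.1 then x.2 - y.2 else y.2 - x.2).

(** The other end of the edge of color [c] at [x], or [x] itself for the color of the diagonal. *)
Definition partner (c : vertex) x : vertex :=
  if c.1 then
    if c.2 == 0 then x else (~~ x.1, if x.1 then x.2 - c.2 else x.2 + c.2)
  else if c.2 - x.2 == x.2 then (~~ x.1, x.2) else (x.1, c.2 - x.2).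

Lemma colorC x y : color x y = color y x.
Proof.
rewrite /color ![y.1 == _]eq_sym ![y.2 == _]eq_sym addrC.
by case: x y => [[] i] [[] j].
Qed.

Lemma colorxx x : color x x = (true, 0).
Proof. by rewrite /color !eqxx. Qed.

Lemma color_partner c x : color x (partner c x) = c.
Proof.
case: c x => [[] t] [s i] /=; rewrite /partner /color /=.
  have [->|t0] := eqVneq t 0; first by rewrite !eqxx.
  case: s => /=.
    by rewrite -subr_eq0 subKr (negPf t0).
  by rewrite addrC -subr_eq0 opprD addrCA subrr addr0 oppr_eq0 (negPf t0) addrK.
have [e|ne] := eqVneq (t - i) i; rewrite /= ?eqxx; last first.
  by rewrite eq_sym (negPf ne) addrC subrK.
by case: s => /=; rewrite -[X in X + _]e subrK.
Qed.

Lemma partner_color x y : partner (color x y) x = y.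
Proof.
case: x y => [s i] [s' j]; rewrite /partner /color /=.
have [<-|ns] := eqVneq s s'; have [<-|ni] := eqVneq i j => /=.
- by rewrite eqxx.
- by rewrite addrAC subrr add0r eq_sym (negPf ni).
- by rewrite addrK eqxx; case: s s' ns => [] [].
- case: s s' ns => [] [] //= _.
    by rewrite subr_eq0 (negPf ni) subKr.
  by rewrite subr_eq0 eq_sym (negPf ni) addrC subrK.
Qed.

(** A total order orients the edges. In a codeword xx'yy' both edges are oriented alike, which
    decides on which side of y the letter y' goes. *)
Definition ranked x y : bool := (pickle x <= pickle y)%N.

Lemma ranked_anti x y : ranked x y = ranked y x -> x = y.
Proof.
move=> e; apply: (pcan_inj pickleK); apply/eqP; rewrite eqn_leq.
by move: e (leq_total (pickle x) (pickle y)); rewrite /ranked => ->; rewrite orbb => ->.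
Qed.

Definition alphabet := (block_label * vertex)%type.
Implicit Types (w : alphabet * alphabet * alphabet) (a b c d : alphabet).

Definition base_letter (l : alphabet) : base := (l.1, l.2.1).
Definition weight (l : alphabet) : Z := l.2.2.
Definition weight3 w : Z := let: (a, b, c) := w in weight a + weight b + weight c.

Definition match_letter (a b c : alphabet) : alphabet :=
  (c.1, partner (color a.2 b.2) c.2).
Arguments match_letter : simpl never.

(* The base design is blown up by letting the weights of the four letters of a
   codeword sum to 0. *)
Definition extend w : alphabet * alphabet * alphabet * alphabet :=
  let: (a, b, c) := w in
  if same_block a b then
    let c' := match_letter a b c in
    if ranked a.2 b.2 == ranked c.2 c'.2 then (a, b, c, c') else (a, b, c', c)
  else if same_block b c then
    let a' := match_letter b c a in
    if ranked b.2 c.2 == ranked a.2 a'.2 then (a, a', b, c) else (a', a, b, c)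
  else if completion (map3 base_letter w) is Some (i, l)
  then ins i (l.1, (l.2, - weight3 w)) w else (a, a, b, c).

Definition block_quad (v : alphabet * alphabet * alphabet * alphabet) : Prop :=
  let: (a, b, c, d) := v in
  [/\ same_block a b, same_block c d, a.1.1 != c.1.1,
      color a.2 b.2 = color c.2 d.2 & ranked a.2 b.2 = ranked c.2 d.2].

(** Reversing an edge that is not a loop reverses its orientation. If x'y' is a loop then so is xy,
    loops having a color of their own. *)
Lemma ranked_swap x y x' y' : color x y = color x' y' ->
  ranked x y != ranked x' y' -> ranked x y = ranked y' x'.
Proof.
move=> exy nr; have [e|ne] := eqVneq x' y'.
  suff e' : x = y by rewrite e e' /ranked !leqnn.
  by rewrite -[y](partner_color x) exy e colorxx -(colorxx x) partner_color.
have: ranked x' y' != ranked y' x' by apply: contraNneq ne => /ranked_anti->.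
by move: nr; do 3!case: ranked.
Qed.

Lemma block_quad_extend a b c : mixed3 (a, b, c) -> block_word (a, b, c) ->
  block_quad (extend (a, b, c)).
Proof.
rewrite /= => mw bw; case: ifP bw => [ab _|_ /= bc].
  have ac : a.1.1 != c.1.1 by move: mw; rewrite (eqP ab) eqxx.
  have cc := color_partner (color a.2 b.2) c.2.
  case: eqP => [h|/eqP h]; split; rewrite // /same_block ?eqxx //.
    by rewrite [RHS]colorC.
  exact: (ranked_swap (esym cc) h).
rewrite bc; have ab : a.1.1 != b.1.1.
  by move: mw; rewrite (eqP bc) eqxx andbT.
have cc := color_partner (color b.2 c.2) a.2.
case: eqP => [h|/eqP h]; split; rewrite // /same_block ?eqxx //.
  by rewrite [LHS]colorC.
by rewrite -(ranked_swap (esym cc) h).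
Qed.

Lemma match_letterE a b c d : color a.2 b.2 = color c.2 d.2 -> c.1 = d.1 ->
  match_letter a b c = d.
Proof. by case: d => [p x] /= e cd; rewrite /match_letter e cd partner_color. Qed.

(** A deletion leaves one pair intact: its color gives back the missing letter, its orientation the
    place of that letter. *)
Lemma extend_block_quad v j : block_quad v ->
  mixed3 (del j v) /\ extend (del j v) = v.
Proof.
case: v => [[[a b] c] d] [ab cd ac col rk]; move: j.
have bc : same_block b c = false.
  by apply: contraNF ac => e; rewrite (eqP ab) (eqP e).
have ac' : same_block a c = false.
  by apply: contraNF ac => e; rewrite (eqP e).
have bd : same_block b d = false by rewrite /same_block -(eqP cd).
have sw (x y : alphabet) : same_block x y -> ranked x.2 y.2 = ranked y.2 x.2 -> x = y.
  by case: x y => [p x] [p' y] /eqP/= -> /ranked_anti->.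
have ba : b.1 = a.1 by rewrite (eqP ab).
have dc : d.1 = c.1 by rewrite (eqP cd).
apply: (delP (P := fun w => mixed3 w /\ extend w = (a, b, c, d)));
  split; rewrite /mixed3 /extend ?bc ?ac' ?bd ?ab ?cd ?ba ?dc ?(negPf ac) //.
- rewrite (@match_letterE _ _ _ a) //; last by rewrite [RHS]colorC.
  (* The wrong order passes the test only if [a = b], when both orders agree. *)
  by case: eqP => // e; rewrite (sw a b ab (etrans rk e)).
- by rewrite (@match_letterE _ _ _ b) // rk eqxx.
- by rewrite eqxx.
- rewrite (@match_letterE _ _ _ c) //; last by rewrite [RHS]colorC.
  by case: eqP => // e; rewrite (sw c d cd (etrans (esym rk) e)).
- by rewrite eqxx.
- by rewrite (@match_letterE _ _ _ d) // rk eqxx.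
Qed.

Definition weight4 (v : alphabet * alphabet * alphabet * alphabet) : Z :=
  let: (a, b, c, d) := v in weight a + weight b + weight c + weight d.

Lemma weight4_ins j l w : weight4 (ins j l w) = weight l + weight3 w.
Proof.
case: w => [[a b] c]; case: j => [|[|[|j]]] /=; rewrite ?addrA //.
- by rewrite [weight a + weight l]addrC.
- by rewrite [weight a + weight b + weight l]addrC !addrA.
- by rewrite [LHS]addrC !addrA.
Qed.

Lemma extend_completion i l w : ~~ block_word w ->
  completion (map3 base_letter w) = Some (i, l) ->
  extend w = ins i (l.1, (l.2, - weight3 w)) w.
Proof.
case: w => [[a b] c] /= /norP[/negPf-> /negPf->] /=.
by case: i => [|[|[|i]]] ->.
Qed.

Lemma mixed3_base w : mixed3 (map3 base_letter w) = mixed3 w.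
Proof. by case: w => [[a b] c]. Qed.

Lemma block_word_base w : block_word (map3 base_letter w) = block_word w.
Proof. by case: w => [[a b] c]. Qed.

Lemma extendP w : mixed3 w ->
  (exists2 i, (i < 4)%N & w = del i (extend w)) /\
  forall j, (j < 4)%N ->
    mixed3 (del j (extend w)) /\ extend (del j (extend w)) = extend w.
Proof.
move=> mw; have [bw|nbw] := boolP (block_word w).
  case: w mw bw => [[a b] c] mw bw; have bq := block_quad_extend mw bw.
  split=> [|j _]; last exact: extend_block_quad.
  move: bw; rewrite /=; case: ifP => [_ _|_ /= ->]; case: ifP => _.
  - by exists 3.
  - by exists 2.
  - by exists 1.
  - by exists 0.
have [|//|i [l [cw lti ok]]] := @completionP (map3 base_letter w).
- by rewrite mixed3_base.
- by rewrite block_word_base.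
have ev := extend_completion nbw cw; split.
  by exists i => //; rewrite ev del_ins.
move=> j /ok [].
(* Since the total weight is 0, the weight of each letter is the opposite of the sum of the other
   three, so [extend] restores any deleted letter. *)
set v := extend w; have vw : weight4 v = 0.
  by rewrite /v ev weight4_ins addNr.
have <- : map4 base_letter v = ins i l (map3 base_letter w).
  by rewrite /v ev map4_ins; case: (l).
rewrite -map3_del mixed3_base block_word_base letter_map4 => mj bj cj.
split=> //; rewrite (extend_completion bj cj) -[RHS](ins_del j); congr ins.
rewrite -(ins_del j v) weight4_ins in vw; rewrite -(addr0_eq vw) opprK.
by rewrite /weight; case: (letter j v) => [p [s z]].
Qed.

End Completion.
Arguments extend {Z} w.

(** * Codes on an arbitrary alphabet *)

Definition del_code (T : finType) (C : {set T * T * T * T}) : Prop :=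
  forall u v i j, u \in C -> v \in C -> i < 4 -> j < 4 ->
  del i u = del j v -> u = v.

Section Transfer.
Variables (T : finType) (q : nat) (f : T -> 'I_q).
Hypothesis f_inj : injective f.

Definition tuple4 (v : T * T * T * T) : 4.-tuple 'I_q :=
  let: (a, b, c, d) := v in [tuple f a; f b; f c; f d].

Definition seq3 (w : T * T * T) : seq 'I_q :=
  let: (a, b, c) := w in [:: f a; f b; f c].

Lemma tuple4_inj : injective tuple4.
Proof.
move=> [[[a b] c] d] [[[a' b'] c'] d'] /(congr1 val)[].
by move=> /f_inj-> /f_inj-> /f_inj-> /f_inj->.
Qed.

Lemma seq3_inj : injective seq3.
Proof. by move=> [[a b] c] [[a' b'] c'] [/f_inj-> /f_inj-> /f_inj->]. Qed.

Lemma del1_tuple4 v : del1 (tuple4 v) = [seq seq3 (del j v) | j <- iota 0 4].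
Proof. by case: v => [[[a b] c] d]. Qed.

Lemma has_del1_tuple4 u v :
  reflect (exists i j, [/\ i < 4, j < 4 & del i u = del j v])
          (has (fun w => w \in del1 (tuple4 v)) (del1 (tuple4 u))).
Proof.
rewrite !del1_tuple4; apply: (iffP hasP) => [[_ /mapP[i + ->] /mapP[j + e]]|].
  by rewrite !mem_iota => lti ltj; exists i, j; split=> //; apply: seq3_inj.
move=> [i [j [lti ltj e]]]; exists (seq3 (del i u)).
  by apply/mapP; exists i; rewrite ?mem_iota.
by apply/mapP; exists j; rewrite ?mem_iota ?e.
Qed.

Lemma del_code_leq_N1 (C : {set T * T * T * T}) : del_code C -> #|C| <= N1 4 q.
Proof.
move=> cC; rewrite -(card_imset _ tuple4_inj).
apply: (leq_bigmax_cond (F := fun C : {set 4.-tuple 'I_q} => #|C|)).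
apply/forall_inP => _ /imsetP[u uC ->]; apply/forall_inP => _ /imsetP[v vC ->].
apply/implyP; apply: contra => /has_del1_tuple4[i [j [lti ltj e]]].
by rewrite (cC u v i j).
Qed.

Lemma N1_del_code : #|T| = q ->
  exists2 C : {set T * T * T * T}, del_code C & #|C| = N1 4 q.
Proof.
move=> cT; have [|C sC NC] := @eq_bigmax_cond _ (@single_del_code 4 q) (fun C => #|C|).
  apply/card_gt0P; exists set0; apply/forall_inP => x; by rewrite inE.
exists (tuple4 @^-1: C).
  move=> u v i j; rewrite !inE => uC vC lti ltj e.
  apply: tuple4_inj; apply/eqP; move/forall_inP: sC => /(_ _ uC).
  move=> /forall_inP/(_ _ vC); apply: contraTT => ->; rewrite negbK.
  by apply/has_del1_tuple4; exists i, j.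
rewrite /N1 NC on_card_preimset //.
have [g fK gK] : bijective f by apply: inj_card_bij => //; rewrite card_ord cT.
exists (fun t : 4.-tuple 'I_q =>
  (g (tnth t (inord 0)), g (tnth t (inord 1)),
   g (tnth t (inord 2)), g (tnth t (inord 3)))).
  by move=> [[[a b] c] d] _; rewrite /= !(tnth_nth (f a)) !inordK //= !fK.
move=> t _; apply: eq_from_tnth => i.
rewrite [LHS](tnth_nth (tnth t i)) /= !gK.
by case: i => [[|[|[|[|]]]] lti] //=; congr tnth; apply/val_inj; rewrite /= inordK.
Qed.

End Transfer.

(** * The upper bound *)

Section UpperBound.
Variable T : finType.
Implicit Types (w : T * T * T) (v : T * T * T * T).

Definition dels v : seq (T * T * T) := undup [seq del j v | j <- iota 0 4].

Lemma mem_dels w v : reflect (exists2 j, j < 4 & w = del j v) (w \in dels v).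
Proof.
rewrite mem_undup; apply: (iffP mapP) => [[j]|[j]].
  by rewrite mem_iota; exists j.
by exists j; rewrite ?mem_iota.
Qed.

(** The fiber of [e] over [v] consists of subwords of [v]. *)
Lemma card_leq_sum_dels (W : {set T * T * T}) (e : T * T * T -> T * T * T * T) :
  (forall w, w \in W -> w \in dels (e w)) ->
  #|W| <= \sum_(v in e @: W) size (dels v).
Proof.
move=> We; rewrite -sum1_card (partition_big e (mem (e @: W))) => [|w wW].
  apply: leq_sum => v _; rewrite sum1dep_card.
  apply: leq_trans (card_size (dels v)); apply/subset_leq_card/subsetP => w.
  by rewrite inE => /andP[/We ww /eqP <-].
exact: imset_f.
Qed.

Definition run_weight w := let: (a, b, c) := w in 1 + (a == b) + (b == c).
Definition isolated (b : T) w := let: (a, x, c) := w in [&& x == b, a != b & c != b].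
Definition constant4 v := let: (a, b, c, d) := v in [&& a == b, b == c & c == d].

(** Only the two inner letters of [v] can be middle letters of a subword, so the sum over [b] has at
    most two nonzero terms; the equality patterns of four letters are then checked one by one. *)
Lemma dels_weight v :
  4 + \sum_b odd (\sum_(w <- dels v) isolated b w)
    <= \sum_(w <- dels v) run_weight w + constant4 v.
Proof.
case: v => [[[a b] c] d].
have tE x : x != b -> x != c -> \sum_(w <- dels (a, b, c, d)) isolated x w = 0.
  move=> xb xc; rewrite big1_seq // => w /andP[_ /mem_dels[j _ ->]].
  by case: j => [|[|[|j]]] /=; rewrite [_ == x]eq_sym ?(negPf xb) ?(negPf xc).
have -> : \sum_x odd (\sum_(w <- dels (a, b, c, d)) isolated x w) =
    odd (\sum_(w <- dels (a, b, c, d)) isolated b w) +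
    (c != b) * odd (\sum_(w <- dels (a, b, c, d)) isolated c w).
  rewrite (bigD1 b) //=; congr addn; have [cb|cb] := eqVneq c b.
    by rewrite big1 // => x xb; rewrite tE // cb.
  rewrite (bigD1 c) //= [X in _ + X]big1 ?addn0 ?mul1n // => x /andP[xb xc].
  by rewrite tE.
rewrite /dels /= !inE !xpair_eqE.
repeat (rewrite ?eqxx ?andbF ?big_cons ?big_nil /=; match goal with
  |- context [@eq_op _ ?x ?y] =>
    is_var x; is_var y; case: (eqVneq x y) => ?; [subst x|] end);
rewrite ?big_cons ?big_nil /= ?eqxx //;
by match goal with H : is_true (?x != ?x) |- _ => rewrite eqxx in H end.
Qed.

Lemma sum_triple (F : T * T * T -> nat) :
  \sum_w F w = \sum_a \sum_b \sum_c F (a, b, c).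
Proof.
rewrite pair_bigA (pair_bigA _ (fun p c => F (p.1, p.2, c))) /=.
by apply: eq_bigr => [[[a b] c]].
Qed.

Lemma sum_eq_op (a : T) : \sum_b (a == b) = 1.
Proof.
by rewrite (bigD1 a) //= eqxx big1 // => b /negPf; rewrite eq_sym => ->.
Qed.

Lemma sum_neq_op (a : T) : \sum_b (b != a) = #|T|.-1.
Proof. by rewrite -big_mkcond sum1_card cardC1. Qed.

Lemma sum_run_weight : \sum_w run_weight w = #|T| ^ 3 + 2 * #|T| ^ 2.
Proof.
rewrite sum_triple /=.
under eq_bigr => a _ do under eq_bigr => b _ do
  rewrite !big_split /= sum_eq_op !sum_nat_const.
under eq_bigr => a _ do
  rewrite !big_split /= -[X in _ + X + _]big_distrr /= sum_eq_op !sum_nat_const.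
by rewrite !sum_nat_const !expnS; set n := #|_|; lia.
Qed.

Lemma sum_isolated (b : T) : \sum_w isolated b w = #|T|.-1 ^ 2.
Proof.
rewrite sum_triple /= exchange_big (bigD1 b) //= [X in _ + X]big1 => [|x xb].
  rewrite addn0 eqxx /=.
  under eq_bigr => a _ do under eq_bigr => c _ do rewrite -mulnb.
  by rewrite -big_distrlr /= sum_neq_op.
by rewrite big1 // => a _; rewrite big1 // => c _; rewrite (negPf xb).
Qed.

(** Only the middle letter can be isolated. Hence leaving a word uncovered wastes at least 1 for
    each letter whose parity it affects. *)
Lemma sum_isolated_leq w : \sum_b isolated b w <= run_weight w.
Proof.
case: w => [[a x] c] /=; apply: (@leq_trans 1); last by rewrite -addnA leq_addr.
rewrite -(sum_eq_op x); apply: leq_sum => b _.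
by case: (x == b) => //=; apply: leq_b1.
Qed.

Lemma sum_constant4 (C : {set T * T * T * T}) :
  \sum_(v in C) constant4 v <= #|T|.
Proof.
rewrite -big_mkcondr sum1dep_card /=.
pose diag x : T * T * T * T := (x, x, x, x).
rewrite -cardsT -(card_imset [set: T] (f := diag)) => [|x y [->] //].
apply/subset_leq_card/subsetP => -[[[a b] c] d].
by rewrite inE => /andP[_ /and3P[/eqP-> /eqP-> /eqP->]]; apply: imset_f.
Qed.

(** Reducing each [t i] modulo 2 preserves the parity of the total, and an odd number is
    positive. *)
Lemma odd_sum_gt0 (I : finType) (P : pred I) (t : I -> nat) (n : nat) :
  odd (n + \sum_(i | P i) t i) -> 0 < n + \sum_(i | P i) odd (t i).
Proof.
move=> h; have : odd (n + \sum_(i | P i) odd (t i)).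
  move: h; rewrite !oddD; congr (_ (+) _).
  by elim/big_ind2: _ => // [x x' y y'|i _]; rewrite ?oddD ?oddb // => -> ->.
by case: (n + _).
Qed.

Section Covering.
Variable C : {set T * T * T * T}.
Hypothesis codeC : del_code C.

Definition coverage w := \sum_(v in C) (w \in dels v).

Lemma coverage_leq1 w : coverage w <= 1.
Proof.
rewrite /coverage -big_mkcondr sum1dep_card.
apply/card_le1_eqP => u v.
rewrite !inE => /andP[uC /mem_dels[i lti ->]] /andP[vC /mem_dels[j ltj e]].
by rewrite (codeC uC vC lti ltj e).
Qed.

Lemma sum_dels (F : T * T * T -> nat) :
  \sum_(v in C) \sum_(w <- dels v) F w = \sum_w coverage w * F w.
Proof.
under eq_bigr => v _ do rewrite big_uniq ?undup_uniq // big_mkcond.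
rewrite exchange_big; apply: eq_bigr => w _; rewrite big_distrl.
by apply: eq_bigr => v _ /=; case: ifP => _; rewrite ?mul1n.
Qed.

Lemma sum_coverage (F : T * T * T -> nat) :
  \sum_w F w = \sum_w (1 - coverage w) * F w + \sum_w coverage w * F w.
Proof.
rewrite -big_split; apply: eq_bigr => w _ /=.
by rewrite -mulnDl subnK ?mul1n // coverage_leq1.
Qed.

Theorem del_code_bound : ~~ odd #|T| -> 4 * #|C| <= #|T| ^ 3 + 2 * #|T| ^ 2.
Proof.
move=> evT.
pose odds v := \sum_b odd (\sum_(w <- dels v) isolated b w).
(* The number (q - 1)^2 of words isolating [b] is odd, so some such word is uncovered or some
   codeword has an odd number of them. *)
have parity b : 0 < \sum_w (1 - coverage w) * isolated b w +
    \sum_(v in C) odd (\sum_(w <- dels v) isolated b w).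
  apply: odd_sum_gt0; rewrite sum_dels -sum_coverage sum_isolated oddX /=.
  have: 0 < #|T| by apply/card_gt0P; exists b.
  by move: evT; case: #|T| => //= n; rewrite negbK.
have h1 : #|T| <= \sum_w (1 - coverage w) * run_weight w + \sum_(v in C) odds v.
  apply: (@leq_trans (\sum_b (\sum_w (1 - coverage w) * isolated b w +
    \sum_(v in C) odd (\sum_(w <- dels v) isolated b w)))).
    by rewrite -sum1_card; apply: leq_sum => b _; apply: parity.
  rewrite big_split /= [X in _ + X]exchange_big leq_add2r exchange_big.
  apply: leq_sum => w _; rewrite -big_distrr leq_mul2l sum_isolated_leq.
  by rewrite orbT.
have h2 : 4 * #|C| + \sum_(v in C) odds v <=
    \sum_w coverage w * run_weight w + #|T|.
  rewrite -sum_dels mulnC -sum_nat_const -big_split /=.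
  apply: leq_trans (leq_add (leqnn _) (sum_constant4 C)).
  by rewrite -big_split; apply: leq_sum => v _; apply: dels_weight.
(* The loss of [#|T|] in [h1] cancels the allowance [#|T|] for constant codewords in [h2]. *)
move: (sum_coverage run_weight); rewrite sum_run_weight.
by move: h1 h2; lia.
Qed.

End Covering.
End UpperBound.

(** * Doubling the alphabet *)

Lemma cardsU_disjoint (T : finType) (A B : {set T}) :
  (forall x, x \in A -> x \notin B) -> #|A :|: B| = #|A| + #|B|.
Proof.
move=> AB; rewrite cardsU (_ : A :&: B = set0) ?cards0 ?subn0 //.
by apply/setP => x; rewrite !inE; apply/negP => /andP[/AB/negP].
Qed.

Section Doubling.
Variable Z : finZmodType.

Let L := alphabet Z.
Definition half_alphabet := (option bool * vertex Z)%type.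
Let H := half_alphabet.

Definition embed (t : bool) (h : H) : L := ((t, h.1), h.2).

Lemma embed_inj t : injective (embed t).
Proof. by move=> [r x] [r' x'] [-> ->]. Qed.

Lemma card_half_alphabet : #|{: H}| = 6 * #|Z|.
Proof. by rewrite !card_prod card_option !card_bool mulnA. Qed.

Lemma card_alphabet : #|{: L}| = 2 * #|{: H}|.
Proof. by rewrite !card_prod !card_option !card_bool; lia. Qed.

Lemma mixed3_embed t (w : H * H * H) : mixed3 (map3 (embed t) w) = false.
Proof. by case: w => [[a b] c]; rewrite /= eqxx. Qed.

Definition mixed_code : {set L * L * L * L} :=
  extend @: [set w : L * L * L | mixed3 w].

Lemma mixed_codeP v j : v \in mixed_code -> j < 4 ->
  mixed3 (del j v) /\ extend (del j v) = v.
Proof. by move=> /imsetP[w]; rewrite inE => /extendP[_ h] -> /h. Qed.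

(** With h letters in each copy, at most 2 h^3 of the 8 h^3 words stay within one copy. *)
Lemma card_mixed_words :
  6 * #|{: H}| ^ 3 <= #|[set w : L * L * L | mixed3 w]|.
Proof.
pose f (p : bool * (H * H * H)) := map3 (embed p.1) p.2.
have sub : ~: [set w : L * L * L | mixed3 w] \subset f @: setT.
  apply/subsetP => -[[[[t r] x] [[t' r'] x']] [[t'' r''] x'']].
  rewrite !inE /= negbK => /andP[/eqP<- /eqP<-].
  by apply/imsetP; exists (t, ((r, x), (r', x'), (r'', x''))).
have := leq_trans (subset_leq_card sub) (leq_imset_card _ _).
rewrite cardsT cardsCs setCK !card_prod !card_option !card_bool !expnS.
by set n := #|_|; lia.
Qed.

Definition doubled (v : L * L * L * L) : bool :=
  let: (a, b, c, d) := v in (a == b) && (c == d).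

(** A word aabb has no subwords other than abb and aab. *)
Lemma size_dels_doubled (v : L * L * L * L) : size (dels v) + 2 * doubled v <= 4.
Proof.
rewrite /dels; have [|_] := boolP (doubled v); last first.
  by rewrite addn0; apply: leq_trans (size_undup _) _; rewrite size_map.
case: v => [[[a b] c] d] /= /andP[/eqP-> /eqP->].
rewrite !inE !eqxx /=; case: (_ || _) => //=; case: (_ == _) => //.
Qed.

(** All words aacc with a and c in different copies are codewords, because all loops have the same
    color and the same value of [ranked]. *)
Lemma card_doubled : 2 * #|{: H}| ^ 2 <= \sum_(v in mixed_code) doubled v.
Proof.
rewrite -big_mkcondr sum1dep_card /=.
pose f (p : bool * (H * H)) :=
  let a := embed p.1 p.2.1 in let c := embed (~~ p.1) p.2.2 in (a, a, c, c).
have f_inj : injective f.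
  by move=> [t [[r x] [r' x']]] [u [[s y] [s' y']]] []; congruence.
have -> : 2 * #|{: H}| ^ 2 = #|f @: setT|.
  by rewrite card_imset // cardsT !card_prod card_bool.
apply/subset_leq_card/subsetP => _ /imsetP[[t [h h']] _ ->].
rewrite inE /f /= !eqxx !andbT.
apply/imsetP; exists (embed t h, embed t h, embed (~~ t) h').
  by rewrite inE /=; case: t.
rewrite /extend /same_block eqxx (@match_letterE _ _ _ _ (embed (~~ t) h')) //.
  by rewrite /ranked !leqnn.
by rewrite !colorxx.
Qed.

Lemma mem_dels_extend (w : L * L * L) : mixed3 w -> w \in dels (extend w).
Proof.
move=> /extendP[]; move: (extend w) => v [i lti ->] _.
by apply/mem_dels; exists i.
Qed.

(** Double counting of the mixed words as subwords of codewords: at most four for each codeword, and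
    two fewer for the doubled ones. *)
Lemma card_mixed_code :
  6 * #|{: H}| ^ 3 + 4 * #|{: H}| ^ 2 <= 4 * #|mixed_code|.
Proof.
have le6 : 6 * #|{: H}| ^ 3 <= \sum_(v in mixed_code) size (dels v).
  apply: leq_trans card_mixed_words _; apply: card_leq_sum_dels => w.
  by rewrite inE; apply: mem_dels_extend.
have le4 : \sum_(v in mixed_code) (size (dels v) + 2 * doubled v)
    <= 4 * #|mixed_code|.
  by rewrite mulnC -sum_nat_const; apply: leq_sum => v _; apply: size_dels_doubled.
move: le4 card_doubled le6; rewrite big_split /= -big_distrr /=.
move: (\sum_(v in _) size _) (\sum_(v in _) doubled _) => s d.
by lia.
Qed.

Variable C0 : {set H * H * H * H}.
Hypothesis codeC0 : del_code C0.

Definition pure_code t : {set L * L * L * L} := map4 (embed t) @: C0.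

Definition double_code := pure_code false :|: pure_code true :|: mixed_code.

Lemma pure_codeP t v j : v \in pure_code t ->
  mixed3 (del j v) = false /\ (letter 0 v).1.1 = t.
Proof.
move=> /imsetP[v0 _ ->]; rewrite -map3_del mixed3_embed.
by case: v0 => [[[a b] c] d].
Qed.

(** A subword shows whether its codeword is mixed and, if not, which copy it comes from. The
    codeword is then determined by [extend] or by the code [C0]. *)
Lemma double_code_del : del_code double_code.
Proof.
have pureE u : (u \in pure_code false :|: pure_code true) =
    [exists t, u \in pure_code t].
  rewrite inE; apply/orP/existsP => [[]|[[]]]; by [exists false|exists true|right|left].
move=> u v i j; rewrite inE pureE [v \in _]inE pureE.
case/orP=> [/existsP[t uC]|uC]; case/orP=> [/existsP[t' vC]|vC] lti ltj e.
- move: uC vC e => /imsetP[u0 uC0 ->] /imsetP[v0 vC0 ->]; rewrite -!map3_del => e.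
  have tt' : t = t'.
    by move: e; case: (del i u0) (del j v0) => [[? ?] ?] [[? ?] ?] [].
  rewrite tt' in e *; congr map4; apply: (codeC0 uC0 vC0 lti ltj).
  exact: map3_inj (@embed_inj t') _ _ e.
- by have [] := mixed_codeP vC ltj; rewrite -e; have [-> _] := pure_codeP i uC.
- by have [] := mixed_codeP uC lti; rewrite e; have [-> _] := pure_codeP j vC.
- by have [_ <-] := mixed_codeP uC lti; have [_ <-] := mixed_codeP vC ltj; rewrite e.
Qed.

Lemma card_double_code : #|double_code| = 2 * #|C0| + #|mixed_code|.
Proof.
have cpure t : #|pure_code t| = #|C0|.
  by rewrite card_imset //; apply/map4_inj/embed_inj.
rewrite /double_code cardsU_disjoint => [|v].
  rewrite cardsU_disjoint ?cpure ?addnn ?mul2n // => v.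
  move=> /(pure_codeP 0)[_ e]; apply/negP => /(pure_codeP 0)[_].
  by rewrite e.
rewrite inE => p; apply/negP => /mixed_codeP/(_ (isT : 0 < 4))[].
by case/orP: p => /(pure_codeP 0)[->].
Qed.

End Doubling.

(** * Comparison of the two bounds *)

Lemma card_inj_ord (T : finType) (q : nat) :
  #|T| = q -> exists f : T -> 'I_q, injective f.
Proof. by move=> <-; exists enum_rank; apply: enum_rank_inj. Qed.

Lemma N1_upper_bound q : ~~ odd q -> 4 * N1 4 q <= q ^ 3 + 2 * q ^ 2.
Proof.
have [C cC <-] := @N1_del_code _ q id (fun _ _ e => e) (card_ord q).
by move=> evq; have := del_code_bound cC; rewrite card_ord; apply.
Qed.

Theorem theorem4p2 (m : nat) (hm : 1 <= m) :
  let q := 6 * m in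
  N1 4 q = q ^ 2 * (q + 2) %/ 4 ->
  N1 4 (2 * q) = (2 * q) ^ 2 * (2 * q + 2) %/ 4.
Proof.
(* A successor is needed for the group structure on ['I_m.+1], which serves as Z. *)
move=> q; case: m hm @q => // m _ q Nq.
have cH : #|{: half_alphabet 'I_m.+1}| = q by rewrite card_half_alphabet card_ord.
have [f f_inj] := card_inj_ord cH.
have [C0 codeC0 cC0] := N1_del_code f_inj cH.
have [g g_inj] := card_inj_ord (card_alphabet 'I_m.+1).
have := del_code_leq_N1 g_inj (double_code_del codeC0).
have := card_mixed_code 'I_m.+1; rewrite card_double_code cC0 cH.
have evq : ~~ odd (2 * q) by rewrite oddM.
have := N1_upper_bound evq; move: (N1 4 (2 * q)) => N.
(* As q is even, 4 divides q^2 and the division is exact. *)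
have Nq4 : 4 * N1 4 q = q ^ 2 * (q + 2).
  rewrite Nq mulnC divnK // /q; apply: dvdn_mulr.
  by rewrite expnMn; apply: dvdn_mulr.
(* The lower bound on 4 [N] is 2 (q^3 + 2 q^2) + (6 q^3 + 4 q^2) = (2 q)^3 + 2 (2 q)^2, which is the
   upper bound. *)
move=> up low le; apply/eqP; rewrite eqn_div //; last first.
  by apply: dvdn_mulr; rewrite expnMn; apply: dvdn_mulr.
rewrite !expnS !expn0 ?expn1 ?muln1 in Nq4 up low *.
by apply/eqP; nia.
Qed.
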